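(* For all integers $d_1,d_2\ge0$, the function $I_{d_1,d_2}(z_1,z_2)$ is given by the fermionic formula $$I_{d_1,d_2}(z_1,z_2)=\sum_{\{m_i\}_{i>0},\{n_i\}_{i>0}}\frac{z_1^{-\sum_{i>0} n_i}z_2^{-\sum_{i>0} m_i}q^{\sum_{i>0}(n_i^2+m_i^2-n_im_i)}}{(q)_{d_1-n_1}(q)_{n_1-n_2}(q)_{n_2-n_3}\cdots (q)_{d_2-m_1}(q)_{m_1-m_2}(q)_{m_2-m_3}\cdots},$$ where the sum is over all sequences $\{m_i\}_{i>0},\{n_i\}_{i>0}$ of non-negative integers with $d_1\ge n_1\ge n_2\ge\cdots$, $d_2\ge m_1\ge m_2\ge\cdots$, and $m_i=n_i=0$ for almost all $i$.
   Context: $(a)_n=\prod_{i=0}^{n-1}(1-aq^i)$, and $$I_{d_1,d_2}(z_1,z_2)=\frac{(q z_1^{-1} z_2^{-1})_{d_1+d_2}}{(q)_{d_1} (q)_{d_2}(qz_1^{-1})_{d_1} (qz_2^{-1})_{d_2}(q z_1^{-1} z_2^{-1})_{d_1}(q z_1^{-1} z_2^{-1})_{d_2}}.$$ The identity is one of formal power series in $z_1^{-1},z_2^{-1}$ with coefficients in $\mathbb Q(q)$, where $I_{d_1,d_2}$ is expanded in powers of $z_1^{-1},z_2^{-1}$. *)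

(* Defs.v *)
From HB Require Import structures.
From mathcomp Require Import all_boot all_order all_algebra.
From mathcomp Require Import all_classical.
Set Implicit Arguments.
Unset Strict Implicit.
Unset Printing Implicit Defensive.
Import GRing.Theory.
Local Open Scope classical_set_scope.
Local Open Scope ring_scope.

Record fps (R : Type) := Fps { fcoef : nat -> R }.

HB.instance Definition _ (R : Type) := gen_eqMixin (fps R).
HB.instance Definition _ (R : Type) := gen_choiceMixin (fps R).

Section FpsRing.
Variable R : comUnitRingType.
Implicit Types f g h : fps R.

Lemma fpsP f g : (forall k, fcoef f k = fcoef g k) -> f = g.
Proof. by case: f g => [f] [g] /= /funext ->. Qed.

Definition fpsC (c : R) : fps R := Fps (fun k => if k == 0%N then c else 0).
Definition fpsX : fps R := Fps (fun k => (k == 1%N)%:R).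

Definition fps_add f g : fps R := Fps (fun k => fcoef f k + fcoef g k).
Definition fps_opp f : fps R := Fps (fun k => - fcoef f k).
(** Locked, as unification would otherwise unfold products. *)
Fact fps_mul_key : unit. Proof. exact: tt. Qed.
Definition fps_mul : fps R -> fps R -> fps R := locked_with fps_mul_key
  (fun f g => Fps (fun k => \sum_(j < k.+1) fcoef f j * fcoef g (k - j))).

Lemma fcoef_mul f g k :
  fcoef (fps_mul f g) k = \sum_(j < k.+1) fcoef f j * fcoef g (k - j).
Proof. by rewrite /fps_mul unlock. Qed.

Fact fps_addA : associative fps_add.
Proof. by move=> f g h; apply: fpsP => k /=; rewrite addrA. Qed.
Fact fps_addC : commutative fps_add.
Proof. by move=> f g; apply: fpsP => k /=; rewrite addrC. Qed.
Fact fps_add0 : left_id (fpsC 0) fps_add.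
Proof. by move=> f; apply: fpsP => k /=; rewrite if_same add0r. Qed.
Fact fps_addN : left_inverse (fpsC 0) fps_opp fps_add.
Proof. by move=> f; apply: fpsP => k /=; rewrite if_same addNr. Qed.

HB.instance Definition _ :=
  GRing.isZmodule.Build (fps R) fps_addA fps_addC fps_add0 fps_addN.

Definition fps_trunc n f : {poly R} := \poly_(i < n.+1) fcoef f i.

Lemma coef_fps_trunc n f k : (k <= n)%N -> (fps_trunc n f)`_k = fcoef f k.
Proof. by move=> le_kn; rewrite coef_poly ltnS le_kn. Qed.

Lemma fcoef_mul_trunc n f g k : (k <= n)%N ->
  fcoef (fps_mul f g) k = (fps_trunc n f * fps_trunc n g)`_k.
Proof.
move=> le_kn; rewrite fcoef_mul coefM; apply: eq_bigr => j _.
rewrite !coef_fps_trunc //; first exact: leq_trans (leq_subr _ _) le_kn.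
by apply: leq_trans le_kn; rewrite -ltnS.
Qed.

Fact fps_mulC : commutative fps_mul.
Proof. by move=> f g; apply: fpsP => k; rewrite !(@fcoef_mul_trunc k) // mulrC. Qed.

Lemma fcoef_mul_truncl n f (p : {poly R}) k : (k <= n)%N ->
    (forall j, (j <= n)%N -> fcoef f j = p`_j) ->
  forall g, fcoef (fps_mul f g) k = (p * fps_trunc n g)`_k.
Proof.
move=> le_kn fp g; rewrite fcoef_mul coefM; apply: eq_bigr => j _.
rewrite coef_fps_trunc ?fp //; last exact: leq_trans (leq_subr _ _) le_kn.
by apply: leq_trans le_kn; rewrite -ltnS.
Qed.

Fact fps_mulA : associative fps_mul.
Proof.
move=> f g h; rewrite [fps_mul f _]fps_mulC; apply: fpsP => k.
rewrite (fcoef_mul_truncl (leqnn k) (p := fps_trunc k g * fps_trunc k h)).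
  rewrite (fcoef_mul_truncl (leqnn k) (p := fps_trunc k f * fps_trunc k g)).
    by rewrite mulrC mulrA.
  by move=> j le_jk; rewrite (fcoef_mul_trunc _ _ le_jk).
by move=> j le_jk; rewrite (fcoef_mul_trunc _ _ le_jk).
Qed.

Fact fps_mul1 : left_id (fpsC 1) fps_mul.
Proof.
move=> f; apply: fpsP => k; rewrite fcoef_mul.
by rewrite big_ord_recl /= mul1r subn0 big1 ?addr0 // => i _; rewrite mul0r.
Qed.

Fact fps_mulDl : left_distributive fps_mul fps_add.
Proof.
move=> f g h; apply: fpsP => k; rewrite fcoef_mul /= !fcoef_mul.
by rewrite -big_split; apply: eq_bigr => j _; rewrite mulrDl.
Qed.

Fact fps_1_neq0 : fpsC 1 != 0.
Proof.
by apply/eqP => /(congr1 (fun f => fcoef f 0)) /= /eqP; rewrite oner_eq0.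
Qed.

HB.instance Definition _ := GRing.Zmodule_isComNzRing.Build (fps R)
  fps_mulA fps_mulC fps_mul1 fps_mulDl fps_1_neq0.

Lemma fcoefM f g k :
  fcoef (f * g) k = \sum_(j < k.+1) fcoef f j * fcoef g (k - j).
Proof. exact: fcoef_mul. Qed.

Lemma fcoef0M f g : fcoef (f * g) 0 = fcoef f 0 * fcoef g 0.
Proof. by rewrite fcoefM big_ord1. Qed.

Lemma fcoef0B f g : fcoef (f - g) 0 = fcoef f 0 - fcoef g 0.
Proof. by []. Qed.

Definition fps_unit : pred (fps R) := fun f => fcoef f 0 \is a GRing.unit.

Fixpoint fps_inv_seq f n : seq R :=
  if n is n'.+1 then
    let s := fps_inv_seq f n' in
    rcons s (- ((fcoef f 0)^-1 * \sum_(j < n) fcoef f j.+1 * s`_(n' - j)))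
  else [:: (fcoef f 0)^-1].

Definition fps_inv f : fps R :=
  if fps_unit f then Fps (fun n => (fps_inv_seq f n)`_n) else f.

Lemma size_fps_inv_seq f n : size (fps_inv_seq f n) = n.+1.
Proof. by elim: n => //= n IHn; rewrite size_rcons IHn. Qed.

Lemma nth_fps_inv_seq f n k : (k <= n)%N ->
  (fps_inv_seq f n)`_k = (fps_inv_seq f k)`_k.
Proof.
elim: n => [|n IHn]; first by rewrite leqn0 => /eqP ->.
rewrite leq_eqVlt => /predU1P[-> //|lt_kn].
by rewrite /= nth_rcons size_fps_inv_seq lt_kn IHn.
Qed.

Fact fps_mulVf : {in fps_unit, left_inverse 1 fps_inv *%R}.
Proof.
move=> f Uf; have Uf0 : fcoef f 0 \is a GRing.unit by [].
rewrite mulrC /fps_inv (_ : fps_unit f) //; apply: fpsP => -[|n].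
  by rewrite fcoef0M /= divrr.
rewrite fcoefM big_ord_recl /= subn0 nth_rcons size_fps_inv_seq ltnn eqxx.
rewrite mulrN mulrA divrr // mul1r; apply/eqP; rewrite addrC subr_eq0; apply/eqP.
apply: eq_bigr => j _; rewrite /bump /= add1n subSS.
by rewrite [in RHS]nth_fps_inv_seq // leq_subr.
Qed.

Fact fps_unitPl f g : g * f = 1 -> fps_unit f.
Proof.
move/(congr1 (fun f => fcoef f 0)); rewrite fcoef0M /= => gf1.
by apply/unitrP; exists (fcoef g 0); split=> //; rewrite mulrC.
Qed.

Fact fps_inv_out : {in [predC fps_unit], fps_inv =1 id}.
Proof. by move=> f; rewrite inE /fps_inv /in_mem /= => /negPf ->. Qed.

HB.instance Definition _ := GRing.ComNzRing_hasMulInverse.Build (fps R)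
  fps_mulVf fps_unitPl fps_inv_out.

Lemma fps_unitE f : (f \is a GRing.unit) = (fcoef f 0 \is a GRing.unit).
Proof. by []. Qed.

Fact fpsC_is_zmod_morphism : zmod_morphism fpsC.
Proof. by move=> a b; apply: fpsP => -[|k] //=; rewrite subr0. Qed.
Fact fpsC_is_monoid_morphism : monoid_morphism fpsC.
Proof.
split=> [//|a b]; apply: fpsP => -[|k]; first by rewrite fcoef0M.
rewrite fcoefM big_ord_recl /= mulr0 add0r big1 // => j _.
by rewrite mul0r.
Qed.
HB.instance Definition _ :=
  GRing.isZmodMorphism.Build R (fps R) fpsC fpsC_is_zmod_morphism.
HB.instance Definition _ :=
  GRing.isMonoidMorphism.Build R (fps R) fpsC fpsC_is_monoid_morphism.

End FpsRing.

(** [zser K] is K[[z1^-1]][[z2^-1]]: the inner variable is [z1^-1], the outer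
    one is [z2^-1]. *)
Definition zser (K : fieldType) : comUnitRingType := fps (fps K).

(** Coefficient of [z1^-a * z2^-b]. *)
Definition zcoef (K : fieldType) (F : zser K) (a b : nat) : K :=
  fcoef (fcoef F b) a.

(** [F] is the formal sum over [A] of the family [u]: each monomial occurs in
    finitely many [u i], and its coefficients add up to that of [F]. *)
Definition is_formal_sum (K : fieldType) (T : choiceType) (A : set T)
    (u : T -> zser K) (F : zser K) : Prop :=
  forall a b : nat,
    finite_set (A `&` [set i | zcoef (u i) a b != 0]) /\
    zcoef F a b = \sum_(i \in A) zcoef (u i) a b.

Section Fermionic.
Variables (K : fieldType) (q : K).

Definition zq : zser K := fpsC (fpsC q).
Definition z1inv : zser K := fpsC (fpsX K).
Definition z2inv : zser K := fpsX (fps K).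

Definition poch (a : zser K) (n : nat) : zser K :=
  \prod_(i < n) (1 - a * zq ^+ i).

Definition Iden (d1 d2 : nat) : zser K :=
  poch zq d1 * poch zq d2 * poch (zq * z1inv) d1 * poch (zq * z2inv) d2
  * poch (zq * z1inv * z2inv) d1 * poch (zq * z1inv * z2inv) d2.

(** The quotient is taken in [zser K]; by [Iden_unit] the denominator is
    invertible there, so this is the expansion in [z1^-1] and [z2^-1]. *)
Definition Ifun (d1 d2 : nat) : zser K :=
  poch (zq * z1inv * z2inv) (d1 + d2) / Iden d1 d2.

(** A sequence [n_1, n_2, ...] is encoded as [n : nat -> nat] with [n i]
    standing for [n_(i+1)]. *)
Definition fermionic_seq (d : nat) (n : nat -> nat) : Prop :=
  [/\ (n 0%N <= d)%N, forall i, (n i.+1 <= n i)%N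
    & finite_set [set i | n i != 0%N]].

Definition fermionic_index (d1 d2 : nat) : set ((nat -> nat) * (nat -> nat)) :=
  [set nm | fermionic_seq d1 nm.1 /\ fermionic_seq d2 nm.2].

(** The natural number subtractions below do not truncate when [n] and [m]
    are as in [fermionic_index]; the one in the exponent of [zq] never does. *)
Definition fermionic_den (d : nat) (n : nat -> nat) : zser K :=
  poch zq (d - n 0%N)
  * \big[*%R/1]_(i \in [set: nat]) poch zq (n i - n i.+1).

Definition fermionic_term (d1 d2 : nat) (nm : (nat -> nat) * (nat -> nat))
    : zser K :=
  let: (n, m) := nm in
  z1inv ^+ (\big[addn/0%N]_(i \in [set: nat]) n i)
  * z2inv ^+ (\big[addn/0%N]_(i \in [set: nat]) m i)
  * zq ^+ (\big[addn/0%N]_(i \in [set: nat])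
             (n i ^ 2 + m i ^ 2 - n i * m i)%N)
  / (fermionic_den d1 n * fermionic_den d2 m).

Lemma poch_unit (a : zser K) n :
  (forall i, zcoef a 0 0 * q ^+ i != 1) -> poch a n \is a GRing.unit.
Proof.
move=> a1; rewrite /poch; elim/big_ind: _ => [|f g Uf Ug|i _].
- exact: unitr1.
- by rewrite unitrM Uf.
- rewrite fps_unitE fcoef0B fps_unitE fcoef0B unitfE subr_eq0 eq_sym.
  rewrite !fcoef0M /zq -!rmorphXn; exact: a1.
Qed.

Hypothesis q_not_root1 : forall i, q ^+ i.+1 != 1.

Lemma poch_zq_unit n : poch zq n \is a GRing.unit.
Proof. by apply: poch_unit => i; rewrite -exprS. Qed.

Lemma Iden_unit d1 d2 : Iden d1 d2 \is a GRing.unit.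
Proof.
have Ux v n : zcoef v 0 0 = 0 -> poch v n \is a GRing.unit.
  by move=> v0; apply: poch_unit => i; rewrite v0 mul0r eq_sym oner_eq0.
have c1 : zcoef (zq * z1inv) 0 0 = 0.
  by rewrite /zcoef !fcoef0M mulr0.
have c2 : zcoef (zq * z2inv) 0 0 = 0.
  by rewrite /zcoef !fcoef0M mulr0.
have c12 : zcoef (zq * z1inv * z2inv) 0 0 = 0.
  by rewrite /zcoef !fcoef0M !mulr0.
by rewrite /Iden !unitrM !poch_zq_unit (Ux _ _ c1) (Ux _ _ c2) !(Ux _ _ c12).
Qed.

Lemma fermionic_den_unit d n : fermionic_den d n \is a GRing.unit.
Proof.
rewrite /fermionic_den unitrM poch_zq_unit /=.
elim/big_ind: _ => [|f g Uf Ug|i _]; [exact: unitr1| |exact: poch_zq_unit].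
by rewrite unitrM Uf.
Qed.

End Fermionic.

Definition Qq : fieldType := {fraction {poly rat}}.
Definition qvar : Qq := FracField.tofrac ('X : {poly rat}).

Lemma qvar_not_root1 i : qvar ^+ i.+1 != 1.
Proof.
rewrite /qvar -tofracXn -tofrac1 tofrac_eq; apply/eqP => /(congr1 (size \o val)).
by rewrite /= size_polyXn size_poly1.
Qed.

(* Main.v *)
Require Import Defs.
From mathcomp Require Import all_boot all_order all_algebra.
From mathcomp Require Import all_classical.
From mathcomp Require Import ring zify.

(** Write x = z1^-1, y = z2^-1 and c = q x y. Splitting off the first entries
    (h, h') = (n_1, m_1) of the two sequences shows that the fermionic sum
    satisfies

      F(d1, d2) = sum over h <= d1, h' <= d2 of
        x^h y^h' q^(h^2 + h'^2 - h h') / ((q)_(d1-h) (q)_(d2-h')) F(h, h').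

    The point is that I satisfies the same recursion ([Ifun_recursion]). Every
    term with (h, h') <> (0, 0) carries a nontrivial monomial in x and y, and
    I(0, 0) = F(0, 0) = 1, so iterating the recursion determines the
    coefficients in increasing total degree, and I = F.

    The recursion for I is proved by decoupling the two summations
    ([qI_recursion]). One form of the q-Vandermonde sum,

      (c)_(n+m) / ((c)_n (c)_m (q)_n (q)_m)
        = sum over k of q^((n-k)(m-k)) / ((q)_(n-k) (q)_(m-k) (q)_k (c)_k),

    applied to the factor I(h, h') on the right-hand side produces
    q^(h h' - h k - h' k + k^2), which cancels the coupling q^(- h h'). For
    fixed k the sums over h and h' then separate, and each of them is evaluated
    by Cauchy's Durfee-rectangle identity ([durfee_sum]). What remains is a
    single sum over k, which is the other form of q-Vandermonde,

      (c)_(n+m) / ((c)_n (c)_m (q)_n (q)_m)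
        = sum over k of c^k q^(k(k-1)) / ((q)_(n-k) (q)_(m-k) (q)_k (c)_k),

    and gives I(d1, d2) back. Both forms of q-Vandermonde follow by induction
    on n from the two q-Pascal rules; Cauchy's identity is a limit case of the
    second one. *)

Set Implicit Arguments.
Unset Strict Implicit.
Unset Printing Implicit Defensive.
Import GRing.Theory.
Local Open Scope classical_set_scope.
Local Open Scope ring_scope.

(** * Summation formulas for q-shifted factorials *)

Section QSeries.
Variables (R : comUnitRingType) (q : R).

Definition qpoch (a : R) (n : nat) : R := \prod_(i < n) (1 - a * q ^+ i).

Lemma qpoch0 a : qpoch a 0 = 1.
Proof. exact: big_ord0. Qed.

Lemma qpochSr a n : qpoch a n.+1 = qpoch a n * (1 - a * q ^+ n).
Proof. exact: big_ord_recr. Qed.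

Lemma qpochS a n : qpoch a n.+1 = (1 - a) * qpoch (a * q) n.
Proof.
rewrite /qpoch big_ord_recl mulr1; congr (_ * _).
by apply: eq_bigr => i _; rewrite exprS mulrA.
Qed.

Lemma qpochD a m n : qpoch a (m + n) = qpoch a m * qpoch (a * q ^+ m) n.
Proof.
elim: m a => [|m IHm] a; first by rewrite qpoch0 mul1r mulr1.
by rewrite addSn !qpochS IHm exprS !mulrA.
Qed.

(** All inverses of [qpoch a n] exist. The formulas below are needed in a ring
    of power series, which is not a field; this is what replaces a <> q^(-i). *)
Definition qgeneric (a : R) := forall i, 1 - a * q ^+ i \is a GRing.unit.

Lemma qgeneric_shift a k : qgeneric a -> qgeneric (a * q ^+ k).
Proof. by move=> Ua i; rewrite -mulrA -exprD; apply: Ua. Qed.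

Lemma qpoch_unit a n : qgeneric a -> qpoch a n \is a GRing.unit.
Proof. by move=> Ua; apply: rpred_prod => i _; apply: Ua. Qed.

Hypothesis Uq : qgeneric q.

(** The reciprocal of (q)_(n-k), with the usual convention that the reciprocal
    of (q)_j is 0 for j < 0. It makes the recurrences below hold for all k, and
    cuts off summations without bookkeeping on their ranges. *)
Definition rqfact n k : R := if (k <= n)%N then (qpoch q (n - k))^-1 else 0.

Lemma rqfactn0 n : rqfact n 0 = (qpoch q n)^-1.
Proof. by rewrite /rqfact subn0. Qed.

Lemma rqfactSS n k : rqfact n.+1 k.+1 = rqfact n k.
Proof. by []. Qed.

Lemma rqfact_gt n k : (n < k)%N -> rqfact n k = 0.
Proof. by move=> lt_nk; rewrite /rqfact leqNgt lt_nk. Qed.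

Lemma qpoch_qSV n : (1 - q ^+ n.+1) * (qpoch q n.+1)^-1 = (qpoch q n)^-1.
Proof.
have := qpochSr q n; rewrite -exprS => ->; rewrite invrM ?qpoch_unit //.
  by rewrite mulrA divrr ?mul1r // exprS; apply: Uq.
by rewrite exprS; apply: Uq.
Qed.

Lemma rqfactS n k : (1 - q ^+ (n.+1 - k)) * rqfact n.+1 k = rqfact n k.
Proof.
rewrite /rqfact; case: (ltngtP k n.+1) => [lt_kn|lt_nk|->].
- by rewrite -ltnS lt_kn subSn // qpoch_qSV.
- by rewrite mulr0 leqNgt ltnW.
- by rewrite subnn expr0 subrr mul0r ltnn.
Qed.

Lemma rqfactSr n k : rqfact n k.+1 = (1 - q ^+ (n - k)) * rqfact n k.
Proof.
case: n => [|n]; last by rewrite rqfactS.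
by rewrite sub0n expr0 subrr mul0r rqfact_gt.
Qed.

(** Specialises the free parameter of [q_chu_vandermonde] to a power of q. *)
Lemma rqfact_prod m k :
  q ^+ 'C(k, 2) * rqfact m k =
  (\prod_(i < k) (q ^+ i - q ^+ m)) / qpoch q m.
Proof.
elim: k => [|k IHk]; first by rewrite big_ord0 rqfactn0.
rewrite big_ord_recr /= mulrAC -IHk binS bin1 exprD rqfactSr.
have [le_km|lt_mk] := leqP k m; last by rewrite rqfact_gt // !(mulr0, mul0r).
have -> : q ^+ m = q ^+ k * q ^+ (m - k) by rewrite -exprD subnKC.
ring.
Qed.

(** The two q-Pascal rules, in summed form: they split 1 - q^(n+1) as
    (1 - q^(n+1-k)) + q^(n+1-k) (1 - q^k) and as
    (1 - q^k) + q^k (1 - q^(n+1-k)) respectively. *)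
Lemma sum_rqfact_pascal_r n (f : nat -> R) :
  (1 - q ^+ n.+1) * \sum_(k < n.+2) f k * (rqfact n.+1 k / qpoch q k) =
  \sum_(k < n.+1) f k * (rqfact n k / qpoch q k) +
  \sum_(k < n.+1) q ^+ (n - k) * f k.+1 * (rqfact n k / qpoch q k).
Proof.
rewrite mulr_sumr.
transitivity (\sum_(k < n.+2) (f k * (rqfact n k / qpoch q k) +
   q ^+ (n.+1 - k) * (1 - q ^+ k) * f k * (rqfact n.+1 k / qpoch q k))).
  apply: eq_bigr => k _; rewrite -(rqfactS n).
  have -> : q ^+ n.+1 = q ^+ (n.+1 - k) * q ^+ k.
    by rewrite -exprD subnK // -ltnS.
  ring.
rewrite big_split /=; congr (_ + _).
  by rewrite big_ord_recr /= rqfact_gt // mul0r mulr0 addr0.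
rewrite big_ord_recl /= subrr mulr0 !mul0r add0r; apply: eq_bigr => k _.
rewrite /bump add1n subSS rqfactSS -(qpoch_qSV k); ring.
Qed.

Lemma sum_rqfact_pascal_l n (f : nat -> R) :
  (1 - q ^+ n.+1) * \sum_(k < n.+2) f k * (rqfact n.+1 k / qpoch q k) =
  \sum_(k < n.+1) q ^+ k * f k * (rqfact n k / qpoch q k) +
  \sum_(k < n.+1) f k.+1 * (rqfact n k / qpoch q k).
Proof.
rewrite mulr_sumr.
transitivity (\sum_(k < n.+2) (q ^+ k * f k * (rqfact n k / qpoch q k) +
   (1 - q ^+ k) * f k * (rqfact n.+1 k / qpoch q k))).
  apply: eq_bigr => k _; rewrite -(rqfactS n).
  have -> : q ^+ n.+1 = q ^+ (n.+1 - k) * q ^+ k.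
    by rewrite -exprD subnK // -ltnS.
  ring.
rewrite big_split /=; congr (_ + _).
  by rewrite big_ord_recr /= rqfact_gt // mul0r mulr0 addr0.
rewrite big_ord_recl /= subrr !mul0r add0r; apply: eq_bigr => k _.
rewrite /bump add1n rqfactSS -(qpoch_qSV k); ring.
Qed.

Lemma qpochSrV a n : qgeneric a ->
  (qpoch a n)^-1 = (1 - a * q ^+ n) * (qpoch a n.+1)^-1.
Proof.
move=> Ua; rewrite qpochSr invrM ?(qpoch_unit, Ua) //.
by rewrite mulrA divrr ?mul1r //; apply: Ua.
Qed.

Lemma qpochSV a n : qgeneric a ->
  (qpoch a n.+1)^-1 = (1 - a)^-1 * (qpoch (a * q) n)^-1.
Proof.
move=> Ua; rewrite qpochS invrM; first by rewrite mulrC.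
  by have := Ua 0; rewrite mulr1.
by apply: qpoch_unit; have := @qgeneric_shift a 1 Ua.
Qed.

Lemma unit_1BqS n : 1 - q ^+ n.+1 \is a GRing.unit.
Proof. by rewrite exprS; apply: Uq. Qed.

(** The q-Chu-Vandermonde sum. The product of the s q^i - t is a form of
    s^k (t/s)_k that makes sense for every s, so that t = 0 is allowed (giving
    Cauchy's identity) and the induction can replace s by s q with t fixed. *)
Lemma q_chu_vandermonde n s t : qgeneric s ->
  \sum_(k < n.+1) (q ^+ 'C(k, 2) * \prod_(i < k) (s * q ^+ i - t)
                     / qpoch s k) * (rqfact n k / qpoch q k)
  = qpoch t n / (qpoch s n * qpoch q n).
Proof.
elim: n s => [|n IHn] s Us.
  by rewrite big_ord1 big_ord0 rqfactn0 !qpoch0 !(invr1, mulr1).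
have Usq : qgeneric (s * q) by have := @qgeneric_shift s 1 Us.
apply: (mulrI (unit_1BqS n)).
rewrite (sum_rqfact_pascal_r n (fun k => q ^+ 'C(k, 2) *
  \prod_(i < k) (s * q ^+ i - t) / qpoch s k)) IHn //.
have -> : \sum_(k < n.+1) q ^+ (n - k) * (q ^+ 'C(k.+1, 2) *
    \prod_(i < k.+1) (s * q ^+ i - t) / qpoch s k.+1) *
    (rqfact n k / qpoch q k)
  = q ^+ n * (s - t) / (1 - s) * (qpoch t n / (qpoch (s * q) n * qpoch q n)).
  rewrite -IHn // mulr_sumr; apply: eq_bigr => k _.
  rewrite big_ord_recl mulr1 binS bin1 qpochSV //.
  under [\prod_(i < k) _]eq_bigr => i _ do rewrite lift0 exprS mulrA.
  have -> : q ^+ n = q ^+ (n - k) * q ^+ k by rewrite -exprD subnK // -ltnS.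
  rewrite exprD; ring.
rewrite !invrM ?qpoch_unit // (@qpochSrV s) // (@qpochSV s) //.
rewrite -(qpoch_qSV n) (qpochSr t); ring.
Qed.

(** The q-Vandermonde sum obtained by replacing q by q^-1. Clearing the negative
    powers of q leaves the exponent (n-k)(m-k); the induction step uses the
    other Pascal rule and lowers m together with n. *)
Lemma q_vandermonde_rect n m c : qgeneric c ->
  \sum_(k < n.+1) (q ^+ ((n - k) * (m - k)) * rqfact m k / qpoch c k)
     * (rqfact n k / qpoch q k)
  = qpoch (c * q ^+ m) n / (qpoch c n * qpoch q n * qpoch q m).
Proof.
elim: n m c => [|n IHn] m c Uc.
  by rewrite big_ord1 rqfactn0 mul0n rqfactn0 !qpoch0 !(invr1, mulr1, mul1r).
have Ucq : qgeneric (c * q) by have := @qgeneric_shift c 1 Uc.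
apply: (mulrI (unit_1BqS n)).
rewrite (sum_rqfact_pascal_l n (fun k =>
  q ^+ ((n.+1 - k) * (m - k)) * rqfact m k
  / qpoch c k)).
have -> : \sum_(k < n.+1) q ^+ k * (q ^+ ((n.+1 - k) * (m - k)) * rqfact m k
    / qpoch c k) * (rqfact n k / qpoch q k)
  = q ^+ m * (qpoch (c * q ^+ m) n / (qpoch c n * qpoch q n * qpoch q m)).
  rewrite -IHn // mulr_sumr; apply: eq_bigr => k _.
  have [le_km|lt_mk] := leqP k m; last first.
    by rewrite rqfact_gt // !(mulr0, mul0r).
  have -> : q ^+ m = q ^+ k * q ^+ (m - k) by rewrite -exprD subnKC.
  have le_kn : (k <= n)%N by rewrite -ltnS.
  rewrite subSn // mulSn exprD; ring.
have -> : \sum_(k < n.+1) q ^+ ((n.+1 - k.+1) * (m - k.+1)) * rqfact m k.+1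
    / qpoch c k.+1 * (rqfact n k / qpoch q k)
  = (1 - q ^+ m) / (1 - c) *
    (qpoch (c * q ^+ m) n / (qpoch (c * q) n * qpoch q n * qpoch q m)).
  case: m => [|m].
    rewrite subrr !mul0r big1 // => k _.
    by rewrite rqfact_gt // mulr0 !mul0r.
  rewrite [in RHS]exprS [c * (q * _)]mulrA.
  transitivity ((1 - c)^-1 * (qpoch (c * q * q ^+ m) n /
    (qpoch (c * q) n * qpoch q n * qpoch q m))).
    rewrite -IHn // mulr_sumr; apply: eq_bigr => k _.
    by rewrite !subSS rqfactSS qpochSV //; ring.
  rewrite !invrM ?unitrM ?qpoch_unit // -(qpoch_qSV m) exprS; ring.
rewrite !invrM ?unitrM ?qpoch_unit // (@qpochSrV c) // (@qpochSV c) //.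
rewrite -(qpoch_qSV n) (qpochSr (c * _)); ring.
Qed.

Lemma prodX_bin2 k : \prod_(i < k) q ^+ i = q ^+ 'C(k, 2).
Proof.
elim: k => [|k IHk]; first by rewrite big_ord0.
by rewrite big_ord_recr /= IHk binS bin1 exprD.
Qed.

Lemma sqn_bin2 k : (k ^ 2 = 'C(k, 2) + 'C(k, 2) + k)%N.
Proof. by elim: k => // k IHk; rewrite binS bin1 -addn1 sqrnD IHk; lia. Qed.

(** For k = 0 this is Cauchy's identity, the case t = 0 of q-Chu-Vandermonde.
    General k reduces to it on replacing h, d and x by k + h, k + d and
    x q^k. *)
Lemma durfee_sum x d k : qgeneric (q * x) ->
  \sum_(h < d.+1) x ^+ h * q ^+ (h * (h - k)) * rqfact d h * rqfact h k
     / qpoch (q * x) h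
  = x ^+ k * rqfact d k / qpoch (q * x) d.
Proof.
move=> Ux; have [le_kd|lt_dk] := leqP k d; last first.
  rewrite (rqfact_gt lt_dk) mulr0 mul0r big1 // => h _.
  rewrite (@rqfact_gt h k) ?mulr0 ?mul0r //.
  by apply: leq_ltn_trans lt_dk; rewrite -ltnS.
rewrite -(subnKC le_kd); set D := (d - k)%N; rewrite -addnS big_split_ord /=.
rewrite big1 ?add0r => [|h _]; last by rewrite (@rqfact_gt h k) ?mulr0 ?mul0r.
have Uk := @qgeneric_shift _ k Ux.
transitivity (x ^+ k / qpoch (q * x) k *
  (qpoch 0 D / (qpoch (q * x * q ^+ k) D * qpoch q D))).
  rewrite -q_chu_vandermonde // mulr_sumr; apply: eq_bigr => j _.
  under [\prod_(i < j) _]eq_bigr => i _ do rewrite subr0 mulrC.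
  rewrite big_split /= prodr_const card_ord prodX_bin2.
  have -> : rqfact (k + D) (k + j) = rqfact D j.
    by rewrite /rqfact leq_add2l subnDl.
  have -> : rqfact (k + j) k = (qpoch q j)^-1.
    by rewrite /rqfact leq_addr addKn.
  rewrite addKn mulnDl mulnn sqn_bin2 qpochD invrM ?qpoch_unit //.
  rewrite !exprD !exprMn -exprM; ring.
have -> : qpoch 0 D = 1 by apply: big1 => i _; rewrite mul0r subr0.
have -> : rqfact (k + D) k = (qpoch q D)^-1 by rewrite /rqfact leq_addr addKn.
rewrite qpochD !invrM ?qpoch_unit //; ring.
Qed.

(** [Ifun] over an arbitrary commutative ring. *)
Definition qI x y n m : R :=
  qpoch (q * x * y) (n + m) /
  (qpoch q n * qpoch q m * qpoch (q * x) n * qpoch (q * y) m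
   * qpoch (q * x * y) n * qpoch (q * x * y) m).

Lemma sum_ord_widen (f : nat -> R) n N : (n <= N)%N ->
  (forall k, (n <= k)%N -> f k = 0) -> \sum_(k < N) f k = \sum_(k < n) f k.
Proof.
move=> le_nN f0; rewrite -(subnKC le_nN) big_split_ord /=.
rewrite [X in _ + X]big1 ?addr0 //.
by move=> i _; rewrite f0 // leq_addr.
Qed.

(** The form of q-Vandermonde that absorbs the coupling q^(- h h'). *)
Lemma qpoch_ratio_rect c n m N : (n < N)%N -> qgeneric c ->
  \sum_(k < N) q ^+ ((n - k) * (m - k)) * rqfact n k * rqfact m k
     / (qpoch q k * qpoch c k)
  = qpoch c (n + m) / (qpoch c n * qpoch c m * qpoch q n * qpoch q m).
Proof.
move=> lt_nN Uc; pose f k := q ^+ ((n - k) * (m - k)) * rqfact n k * rqfact m k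
     / (qpoch q k * qpoch c k).
rewrite (@sum_ord_widen f n.+1) // => [|k lt_nk]; last first.
  by rewrite /f (rqfact_gt lt_nk) mulr0 !mul0r.
transitivity (qpoch (c * q ^+ m) n / (qpoch c n * qpoch q n * qpoch q m)).
  rewrite -q_vandermonde_rect //; apply: eq_bigr => k _.
  by rewrite /f invrM ?qpoch_unit //; ring.
rewrite addnC qpochD !invrM ?unitrM ?qpoch_unit //.
rewrite -[LHS](mulrK (qpoch_unit m Uc)); ring.
Qed.

(** The form of q-Vandermonde that recombines the two Durfee sums. *)
Lemma qpoch_ratio_durfee c n m N : (n < N)%N -> qgeneric c ->
  \sum_(k < N) c ^+ k * q ^+ ('C(k, 2) + 'C(k, 2)) * rqfact n k * rqfact m k
     / (qpoch q k * qpoch c k)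
  = qpoch c (n + m) / (qpoch c n * qpoch c m * qpoch q n * qpoch q m).
Proof.
move=> lt_nN Uc; pose f k := c ^+ k * q ^+ ('C(k, 2) + 'C(k, 2)) * rqfact n k
     * rqfact m k / (qpoch q k * qpoch c k).
rewrite (@sum_ord_widen f n.+1) // => [|k lt_nk]; last first.
  by rewrite /f (rqfact_gt lt_nk) mulr0 !mul0r.
transitivity (qpoch (c * q ^+ m) n / (qpoch c n * qpoch q n) / qpoch q m).
  rewrite -q_chu_vandermonde // mulr_suml; apply: eq_bigr => k _.
  under [\prod_(i < k) (_ - _)]eq_bigr => i _ do rewrite -mulrBr.
  rewrite big_split /= prodr_const card_ord.
  rewrite /f exprD invrM ?qpoch_unit //.
  transitivity (c ^+ k * q ^+ 'C(k, 2) * rqfact n k / qpoch c k / qpoch q k *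
    (q ^+ 'C(k, 2) * rqfact m k)); first by ring.
  rewrite rqfact_prod; ring.
rewrite addnC qpochD !invrM ?unitrM ?qpoch_unit //.
rewrite -[LHS](mulrK (qpoch_unit m Uc)); ring.
Qed.

(** Expanding I(h, h') by [qpoch_ratio_rect] decouples h from h'; see the
    introduction. *)
Lemma qI_recursion x y d1 d2 :
  qgeneric (q * x) -> qgeneric (q * y) -> qgeneric (q * x * y) ->
  qI x y d1 d2 = \sum_(h < d1.+1) \sum_(h' < d2.+1)
    x ^+ h * y ^+ h' * q ^+ (h ^ 2 + h' ^ 2 - h * h')
    / (qpoch q (d1 - h) * qpoch q (d2 - h')) * qI x y h h'.
Proof.
move=> Ux Uy Uc.
have qIE n m : qI x y n m = (qpoch (q * x) n)^-1 / qpoch (q * y) m *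
  (qpoch (q * x * y) (n + m) / (qpoch (q * x * y) n * qpoch (q * x * y) m
    * qpoch q n * qpoch q m)).
  by rewrite /qI !invrM ?unitrM ?qpoch_unit //; ring.
pose A z d h k : R := z ^+ h * q ^+ (h * (h - k)) * rqfact d h * rqfact h k
     / qpoch (q * z) h.
transitivity (\sum_(h < d1.+1) \sum_(h' < d2.+1) \sum_(k < d1.+1)
   q ^+ (k ^ 2) / (qpoch q k * qpoch (q * x * y) k)
     * (A x d1 h k * A y d2 h' k)).
  (* For fixed k the summand is a function of h times a function of h'. *)
  under eq_bigr => h _ do rewrite exchange_big /=.
  rewrite exchange_big /= qIE -(@qpoch_ratio_durfee _ _ _ d1.+1) // mulr_sumr.
  apply: eq_bigr => k _.
  under eq_bigr => h _ do rewrite -mulr_sumr -mulr_sumr.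
  rewrite -mulr_sumr -mulr_suml !durfee_sum // sqn_bin2 !exprD !exprMn.
  ring.
apply: eq_bigr => h _; apply: eq_bigr => h' _.
rewrite qIE -(@qpoch_ratio_rect _ _ _ d1.+1) // 2!mulr_sumr.
apply: eq_bigr => k _.
have [le_kh|lt_hk] := leqP k h; last first.
  by rewrite /A (rqfact_gt lt_hk) !(mulr0, mul0r).
have [le_kh'|lt_hk'] := leqP k h'; last first.
  by rewrite /A (rqfact_gt lt_hk') !(mulr0, mul0r).
rewrite /A /rqfact le_kh le_kh' -ltnS ltn_ord -ltnS ltn_ord.
(* With n = l + a and m = l + b the exponents of both sides are
   l^2 + (l + a) a + (l + b) b, and the subtraction does not truncate. *)
have Eq : q ^+ (h ^ 2 + h' ^ 2 - h * h') * q ^+ ((h - k) * (h' - k))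
    = q ^+ (k ^ 2) * q ^+ (h * (h - k)) * q ^+ (h' * (h' - k)).
  rewrite -!exprD; congr (q ^+ _).
  move: (nat_of_ord h) (nat_of_ord h') (nat_of_ord k) le_kh le_kh' => n m l.
  move=> /subnKC <- /subnKC <-; rewrite !addKn.
  by move: (n - l)%N (m - l)%N => a b; nia.
rewrite !invrM ?qpoch_unit //.
transitivity (q ^+ (k ^ 2) * q ^+ (h * (h - k)) * q ^+ (h' * (h' - k)) *
  (x ^+ h * y ^+ h' / qpoch (q * x) h / qpoch (q * y) h' / qpoch q (d1 - h)
   / qpoch q (d2 - h') / qpoch q (h - k) / qpoch q (h' - k) / qpoch q k
   / qpoch (q * x * y) k)); first by ring.
rewrite -Eq; ring.
Qed.

End QSeries.

(** * Non-increasing sequences with finite support *)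

(** The operations over all indices have finite support only because the
    sequences vanish far out; a common bound L turns them into finite ranges. *)
Lemma fsbig_nat_vanish (T : Type) (idx : T) (op : Monoid.com_law idx) L
    (f : nat -> T) : (forall i, (L <= i)%N -> f i = idx) ->
  \big[op/idx]_(i \in [set: nat]) f i = \big[op/idx]_(i < L) f i.
Proof.
move=> f0; rewrite fsbig_ord; apply/esym/fsbig_widen => // i [_ /negP].
by rewrite -leqNgt => /f0.
Qed.
Arguments fsbig_nat_vanish {T idx op} L {f}.

Lemma fsbig_nat_recl (T : Type) (idx : T) (op : Monoid.com_law idx) L
    (f : nat -> T) : (forall i, (L <= i)%N -> f i.+1 = idx) ->
  \big[op/idx]_(i \in [set: nat]) f i
  = op (f 0%N) (\big[op/idx]_(i \in [set: nat]) f i.+1).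
Proof.
move=> f0; rewrite (fsbig_nat_vanish _ f0) (fsbig_nat_vanish L.+1).
  by rewrite big_ord_recl; under [in LHS]eq_bigr do rewrite lift0.
by case=> // i; apply: f0.
Qed.
Arguments fsbig_nat_recl {T idx op} L {f}.

Definition scons (h : nat) (t : nat -> nat) (i : nat) : nat :=
  if i is j.+1 then t j else h.

(** The sequences of [fermionic_seq d] that vanish from index L on, listed by
    choosing the first entry and then a sequence bounded by it: this is the
    shape in which the recursion of the introduction applies. *)
Fixpoint chains L d : seq (nat -> nat) :=
  if L is L'.+1 then
    [seq scons h t | h <- index_iota 0 d.+1, t <- chains L' h]
  else [:: fun=> 0%N].
Arguments chains : simpl never.

Lemma chainsS L d :
  chains L.+1 d = [seq scons h t | h <- index_iota 0 d.+1, t <- chains L h].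
Proof. by []. Qed.

Lemma chainsP L d n :
  reflect [/\ (n 0%N <= d)%N, forall i, (n i.+1 <= n i)%N
             & forall i, (L <= i)%N -> n i = 0%N] (n \in chains L d).
Proof.
apply: (iffP idP); elim: L d n => [|L IHL] d n.
- by rewrite inE => /eqP ->.
- case/allpairsPdep=> h [t [+ /IHL[t0h tS t0] ->]].
  rewrite mem_index_iota => /andP[_]; rewrite ltnS => le_hd.
  split=> [//|[|i] /=|[|i] //= le_Li]; [exact: t0h|exact: tS|exact: t0].
- by case=> _ _ n0; rewrite inE; apply/eqP/funext => i; rewrite n0.
- case=> n0d nS n0; apply/allpairsPdep.
  exists (n 0%N), (fun i => n i.+1); split.
  + by rewrite mem_index_iota.
  + by apply: IHL; split=> // i le_Li; apply: n0.
  + by apply/funext; case.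
Qed.

Lemma chains_uniq L d : uniq (chains L d).
Proof.
elim: L d => [//|L IHL] d.
apply: (@allpairs_uniq_dep nat (fun=> nat -> nat) _ scons) => //.
  exact: iota_uniq.
case=> h t [h' t'] _ _ /= eq_s; have eq_at i := congr1 (fun s => s i) eq_s.
move: (eq_at 0%N) => /= eq_h; rewrite -eq_h in t' eq_s eq_at *.
by congr (Tagged _ _); apply/funext => i; apply: (eq_at i.+1).
Qed.

Lemma nonincreasing_le (n : nat -> nat) i j : (forall k, (n k.+1 <= n k)%N) ->
  (i <= j)%N -> (n j <= n i)%N.
Proof.
move=> nS /subnKC <-; elim: (j - i)%N => [|k IHk]; first by rewrite addn0.
by rewrite addnS; apply: leq_trans IHk.
Qed.

Lemma fermionic_seq_vanish d n : fermionic_seq d n ->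
  exists L, forall i, (L <= i)%N -> n i = 0%N.
Proof.
case=> _ nS /finite_seqP [X eqX].
exists (\sum_(i <- X) i).+1 => i lt_Xi; apply/eqP/negP => /negP ni.
have : [set i | n i != 0%N] i by [].
rewrite eqX /= => iX; move: lt_Xi.
by rewrite (big_rem i) //= ltnNge leq_addr.
Qed.

Lemma chains_fermionic L d n : n \in chains L d -> fermionic_seq d n.
Proof.
case/chainsP => n0d nS n0; split => //.
apply: (sub_finite_set _ (finite_II L)) => i /= ni.
by rewrite ltnNge; apply: contra ni => /n0/eqP.
Qed.

(** A non-increasing sequence that is nonzero at index L has sum at least L + 1. *)
Lemma fermionic_chains L d n : fermionic_seq d n ->
  (\big[addn/0%N]_(i \in [set: nat]) n i <= L)%N -> n \in chains L d.
Proof.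
move=> Fn; have [M nM] := fermionic_seq_vanish Fn; case: Fn => n0d nS _.
rewrite (fsbig_nat_vanish _ nM) => le_nL; apply/chainsP; split=> // i le_Li.
apply/eqP; rewrite -leqn0 leqNgt; apply/negP => ni_gt0.
have lt_iM : (i < M)%N.
  by rewrite ltnNge; apply/negP => /nM ni0; rewrite ni0 in ni_gt0.
suff : (i < L)%N by rewrite ltnNge le_Li.
apply: leq_trans le_nL; rewrite -(subnKC lt_iM) big_split_ord /=.
apply: leq_trans (leq_addr _ _); rewrite -[leqLHS]card_ord -sum1_card.
apply: leq_sum => j _; apply: leq_trans ni_gt0 _.
by apply: nonincreasing_le; rewrite // -ltnS.
Qed.

(** * Vanishing to a given total degree *)

Section Coefficients.
Variable K : fieldType.
Implicit Types F G : zser K.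

Lemma fcoef_sum (R : comUnitRingType) (I : Type) (r : seq I) (P : pred I)
    (f : I -> fps R) k :
  fcoef (\sum_(i <- r | P i) f i) k = \sum_(i <- r | P i) fcoef (f i) k.
Proof. by elim/big_rec2: _ => [|i y x _ <-] //=; rewrite if_same. Qed.

Lemma fcoefXM (R : comUnitRingType) (f : fps R) k :
  fcoef (fpsX R * f) k = if k is k'.+1 then fcoef f k' else 0.
Proof.
rewrite fcoefM; case: k => [|k]; first by rewrite big_ord1 mul0r.
rewrite !big_ord_recl /= mul0r add0r mul1r subn1 /=.
by rewrite big1 ?addr0 // => i _; rewrite mul0r.
Qed.

Lemma fcoefCM (R : comUnitRingType) c (f : fps R) k :
  fcoef (fpsC c * f) k = c * fcoef f k.
Proof.
rewrite fcoefM big_ord_recl subn0 /= big1 ?addr0 // => i _.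
by rewrite mul0r.
Qed.

Lemma zcoef0 a b : zcoef (0 : zser K) a b = 0.
Proof. by case: b => [|b]; case: a. Qed.

(** F lies in the N-th power of the ideal generated by z1^-1 and z2^-1. *)
Definition zvanish N F := forall a b, (a + b < N)%N -> zcoef F a b = 0.

Lemma zcoef_sum (I : Type) (r : seq I) (P : pred I) (F : I -> zser K) a b :
  zcoef (\sum_(i <- r | P i) F i) a b = \sum_(i <- r | P i) zcoef (F i) a b.
Proof. by rewrite /zcoef !fcoef_sum. Qed.

Lemma zvanish_sum N (I : Type) (r : seq I) (P : pred I) (F : I -> zser K) :
  (forall i, P i -> zvanish N (F i)) -> zvanish N (\sum_(i <- r | P i) F i).
Proof. by move=> F0 a b ab; rewrite zcoef_sum big1 // => i /F0->. Qed.

Lemma zvanishM N F G : zvanish N F -> zvanish N (F * G).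
Proof.
move=> F0 a b ab; rewrite /zcoef fcoefM fcoef_sum big1 // => j _.
rewrite fcoefM big1 // => i _; rewrite [X in X * _](F0 i j) ?mul0r //.
by apply: leq_ltn_trans ab; rewrite leq_add // -ltnS.
Qed.

Lemma zvanish_monomialM N h h' F :
  zvanish N F -> zvanish (h + h' + N) (z1inv K ^+ h * z2inv K ^+ h' * F).
Proof.
move=> F0; elim: h => [|h IHh]; last first.
  move=> a b ab; rewrite exprS -!mulrA [X in _ * X]mulrA /zcoef fcoefCM fcoefXM.
  by case: a ab => // a ab; apply: IHh; rewrite -ltnS.
rewrite mul1r; elim: h' => [|h' IHh']; first by rewrite mul1r.
move=> a b ab; rewrite exprS -mulrA /zcoef fcoefXM.
case: b ab => [|b] ab; first by rewrite /= if_same.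
by apply: IHh'; rewrite -ltnS -addnS.
Qed.

Lemma zvanishW N M F : (N <= M)%N -> zvanish M F -> zvanish N F.
Proof. by move=> le_NM F0 a b ab; apply: F0; apply: leq_trans le_NM. Qed.

End Coefficients.

(** * The fermionic formula *)

Section Recursion.
Variables (K : fieldType) (q : K).
Hypothesis q_not_root1 : forall i, q ^+ i.+1 != 1.
Local Notation x := (z1inv K).
Local Notation y := (z2inv K).
Local Notation Q := (zq q).

Lemma zser_qgeneric (a : zser K) :
  (forall i, zcoef a 0 0 * q ^+ i != 1) -> qgeneric Q a.
Proof.
move=> a1 i; rewrite fps_unitE fcoef0B fps_unitE fcoef0B unitfE subr_eq0 eq_sym.
rewrite !fcoef0M /zq -!rmorphXn; exact: a1.
Qed.

Lemma zq_generic : qgeneric Q Q.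
Proof. by apply: zser_qgeneric => i; rewrite -exprS. Qed.

Lemma zcoef00_generic (a : zser K) : zcoef a 0 0 = 0 -> qgeneric Q a.
Proof.
by move=> a0; apply: zser_qgeneric => i; rewrite a0 mul0r eq_sym oner_eq0.
Qed.

(** The factor contributed by the first entries h and h' of the two sequences. *)
Definition fermionic_weight d1 d2 h h' : zser K :=
  x ^+ h * y ^+ h' * Q ^+ (h ^ 2 + h' ^ 2 - h * h')
  / (poch q Q (d1 - h) * poch q Q (d2 - h')).

Lemma Ifun_recursion d1 d2 :
  Ifun q d1 d2 = \sum_(h < d1.+1) \sum_(h' < d2.+1)
    fermionic_weight d1 d2 h h' * Ifun q h h'.
Proof.
apply: (qI_recursion zq_generic); apply: zcoef00_generic;
  by rewrite /zcoef !fcoef0M !(mulr0, mul0r).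
Qed.

Lemma fermionic_den_scons L d h t : (forall i, (L <= i)%N -> t i = 0%N) ->
  fermionic_den q d (scons h t) = poch q Q (d - h) * fermionic_den q h t.
Proof.
move=> t0; rewrite /fermionic_den /=; congr (_ * _).
rewrite (fsbig_nat_recl L) //= => i le_Li.
by rewrite t0 // sub0n /poch big_ord0.
Qed.

Lemma fermionic_term_scons L d1 d2 h h' t t' :
  (forall i, (L <= i)%N -> t i = 0%N) -> (forall i, (L <= i)%N -> t' i = 0%N) ->
  fermionic_term q d1 d2 (scons h t, scons h' t')
  = fermionic_weight d1 d2 h h' * fermionic_term q h h' (t, t').
Proof.
move=> t0 t'0; rewrite /fermionic_term.
rewrite !(fermionic_den_scons _ _ t0, fermionic_den_scons _ _ t'0).
rewrite (fsbig_nat_recl L (f := scons h t)) //.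
rewrite (fsbig_nat_recl L (f := scons h' t')) //.
rewrite [X in Q ^+ X](fsbig_nat_recl L) => [|i le_Li]; last first.
  by rewrite /= t0 ?t'0.
rewrite /=.
have := fermionic_den_unit q_not_root1 h t.
have := fermionic_den_unit q_not_root1 h' t'.
move: (fermionic_den q h t) (fermionic_den q h' t') => E E' UE' UE.
rewrite /fermionic_weight !exprD !invrM ?unitrM ?poch_zq_unit //.
ring.
Qed.

Definition fermionic_sum L d1 d2 : zser K :=
  \sum_(n <- chains L d1) \sum_(m <- chains L d2) fermionic_term q d1 d2 (n, m).

Lemma fermionic_sum_recursion L d1 d2 :
  fermionic_sum L.+1 d1 d2 = \sum_(h < d1.+1) \sum_(h' < d2.+1)
    fermionic_weight d1 d2 h h' * fermionic_sum L h h'.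
Proof.
rewrite /fermionic_sum chainsS big_allpairs_dep big_mkord.
apply: eq_bigr => h _.
under eq_bigr do rewrite chainsS big_allpairs_dep big_mkord.
rewrite exchange_big /=; apply: eq_bigr => h' _.
rewrite mulr_sumr; apply: eq_big_seq => t /chainsP[_ _ t0].
rewrite mulr_sumr; apply: eq_big_seq => t' /chainsP[_ _ t'0].
exact: fermionic_term_scons t0 t'0.
Qed.

Lemma Ifun00 : Ifun q 0 0 = 1.
Proof. by rewrite /Ifun /Iden /poch !big_ord0 !mulr1 divr1. Qed.

Lemma fermionic_sum00 L : fermionic_sum L 0 0 = 1.
Proof.
elim: L => [|L IHL]; last first.
  rewrite fermionic_sum_recursion !big_ord1 IHL mulr1 /fermionic_weight.
  by rewrite /poch !big_ord0 !mulr1 divr1.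
rewrite /fermionic_sum !big_seq1 /fermionic_term /fermionic_den.
rewrite !(fsbig_nat_vanish 0) // => [|i _]; last by rewrite /poch big_ord0.
by rewrite !big_ord0 /poch !big_ord0 !mulr1 divr1.
Qed.

(** [Ifun] satisfies the recursion that produces [fermionic_sum L.+1] from
    [fermionic_sum L]. A step with (h, h') <> (0, 0) raises the order of
    vanishing by h + h' > 0, and for (h, h') = (0, 0) both series are 1. *)
Lemma Ifun_fermionic_sum L d1 d2 :
  zvanish L (Ifun q d1 d2 - fermionic_sum L d1 d2).
Proof.
elim: L d1 d2 => // L IHL d1 d2.
rewrite Ifun_recursion fermionic_sum_recursion -sumrB.
apply: zvanish_sum => h _; rewrite -sumrB; apply: zvanish_sum => h' _.
rewrite -mulrBr; have [/eqP|] := posnP (h + h')%N.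
  rewrite addn_eq0 => /andP[/eqP-> /eqP->].
  rewrite Ifun00 fermionic_sum00 subrr mulr0 => a b _.
  exact: zcoef0.
move=> hh'; apply: (@zvanishW _ _ (h + h' + L)).
  by rewrite -add1n leq_add2r.
rewrite /fermionic_weight -[_ / _ * _]mulrA -[_ * Q ^+ _ * _]mulrA.
apply: zvanish_monomialM.
by rewrite mulrA mulrC; apply: zvanishM.
Qed.

Lemma fermionic_term_vanish d1 d2 n m :
  zvanish (\big[addn/0%N]_(i \in [set: nat]) n i
           + \big[addn/0%N]_(i \in [set: nat]) m i)
    (fermionic_term q d1 d2 (n, m)).
Proof.
rewrite /fermionic_term -mulrA -[X in zvanish X]addn0.
by apply: zvanish_monomialM.
Qed.

(** Only sequences vanishing from index a + b + 1 on contribute to the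
    coefficient of z1^-a z2^-b, so it can be read off from a truncated sum. *)
Theorem Ifun_fermionic d1 d2 :
  is_formal_sum (fermionic_index d1 d2) (fermionic_term q d1 d2) (Ifun q d1 d2).
Proof.
move=> a b; set L := (a + b).+1.
pose r := [seq (n, m) | n <- chains L d1, m <- chains L d2].
have r_index : [set` r] `<=` fermionic_index d1 d2.
  by move=> _ /allpairsP[[n m] [/= nL mL ->]]; split=> /=;
    [apply: chains_fermionic nL|apply: chains_fermionic mL].
have supp_r : fermionic_index d1 d2
    `&` [set i | zcoef (fermionic_term q d1 d2 i) a b != 0] `<=` [set` r].
  move=> [n m] [[/= Fn Fm]] /eqP zcoef_neq0.
  have le_nm : (\big[addn/0%N]_(i \in [set: nat]) n i
           + \big[addn/0%N]_(i \in [set: nat]) m i <= a + b)%N.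
    rewrite leqNgt; apply/negP => lt_ab.
    by apply: zcoef_neq0; apply: fermionic_term_vanish.
  apply/allpairsP; exists (n, m); split=> //=; apply: fermionic_chains => //.
    by apply: leq_trans (leqW le_nm); apply: leq_addr.
  by apply: leq_trans (leqW le_nm); apply: leq_addl.
split; first exact: sub_finite_set supp_r (finite_seq r).
have /subr0_eq -> : zcoef (Ifun q d1 d2) a b - zcoef (fermionic_sum L d1 d2) a b
    = 0 by apply: (@Ifun_fermionic_sum L d1 d2); apply: ltnSn.
rewrite -(fsbig_widen [set` r]) //; last first.
  by move=> i [Ai /= ri]; apply: contra_notP ri => /eqP ?; apply: supp_r.
rewrite -fsbig_seq; last first.
  apply: allpairs_uniq; [| |by case=> ? ? []]; exact: chains_uniq.
rewrite big_allpairs /fermionic_sum zcoef_sum; apply: eq_bigr => n _.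
by rewrite zcoef_sum.
Qed.

End Recursion.

Theorem corollary7p10 (d1 d2 : nat) :
  is_formal_sum (fermionic_index d1 d2) (fermionic_term qvar d1 d2)
    (Ifun qvar d1 d2).
Proof. exact: Ifun_fermionic qvar_not_root1 d1 d2. Qed.
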